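(* Fix positive integers $n,t,\lambda$ with $t\le n$. There exists a constant $v_0=v_0(n,t,\lambda)$ such that, for every $v\geq v_0$ (with $v\ge 2n$) and every combinatorial $t$-$(v,n,\lambda)$ design $D$, $$\operatorname{span}_{\mathbb{C}}\{g\boldsymbol{1}_D\mid g\in\mathfrak{S}_v\}=U_0\oplus U_{t+1}\oplus U_{t+2}\oplus\cdots\oplus U_n,$$ where $\mathbb{C}^X=U_0\oplus U_1\oplus\cdots\oplus U_n$ is the orthogonal multiplicity-free decomposition of the permutation module on $X=\binom{[v]}{n}$, with $U_j\cong S^{(v-j,j)}$. In particular, $$\dim_{\mathbb{Q}}\operatorname{span}_{\mathbb{Q}}\{g\boldsymbol{1}_D\mid g\in\mathfrak{S}_v\}=\binom{v}{n}-\binom{v}{t}+1.$$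
   Context: $[v]=\{1,\dots,v\}$ and $X=\binom{[v]}{n}$ is the set of all $n$-subsets of $[v]$, with $2n\le v$. A combinatorial $t$-$(v,n,\lambda)$ design is a collection $D\subseteq X$ (no repeated blocks) such that every $t$-subset of $[v]$ is contained in exactly $\lambda$ members of $D$. $\boldsymbol{1}_D\in\mathbb{C}^X$ is the characteristic vector of $D$. The symmetric group $\mathfrak{S}_v$ acts on $X$ and on $\mathbb{C}^X$ by $g\boldsymbol{1}_D=\boldsymbol{1}_{gD}$. By Young's rule, $\mathbb{C}^X$ decomposes as an $\mathfrak{S}_v$-module into an orthogonal direct sum $U_0\oplus\cdots\oplus U_n$ of pairwise non-isomorphic irreducible modules, where $U_j$ is the unique submodule isomorphic to the Specht module $S^{(v-j,j)}$, of dimension $\binom{v}{j}-\binom{v}{j-1}$ (with $\binom{v}{-1}=0$). *)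

(* Defs.v *)
From HB Require Import structures.
From mathcomp Require Import all_boot all_order all_algebra all_fingroup.
From mathcomp Require Import all_solvable.
From mathcomp Require Import reals complex.

Set Implicit Arguments.
Unset Strict Implicit.
Unset Printing Implicit Defensive.

Import GRing.Theory Num.Theory.
Import GroupScope.
Local Open Scope ring_scope.

(* The value type is the regular module F^o, so that the
   functions form a vector space over F even when F = R[i] is itself a module
   over a smaller field. *)
Notation permMod F I := {ffun I -> F^o}.

Section PermutationModules.
Variables (gT : finGroupType) (F : fieldType).
Implicit Types I : finType.

(* With this convention the indicator of D is sent to the indicator of gD. *)
Definition gtrans I (to : {action gT &-> I}) (g : gT) (f : permMod F I) :
    permMod F I :=
  [ffun x => f (to x g^-1%g)].

Definition indic I (D : {set I}) : permMod F I := [ffun x => (x \in D)%:R].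

Definition submodule I (to : {action gT &-> I}) (W : {vspace permMod F I}) :=
  forall g f, f \in W -> gtrans to g f \in W.

Definition irreducible_module I (to : {action gT &-> I})
    (W : {vspace permMod F I}) :=
  [/\ submodule to W, W <> 0%VS &
      forall W' : {vspace permMod F I},
        submodule to W' -> (W' <= W)%VS -> W' = 0%VS \/ W' = W].

(* Every linear map on W1 extends to the whole space, so phi may be taken to
   be defined everywhere; only its restriction to W1 matters. *)
Definition module_iso I1 I2
    (to1 : {action gT &-> I1}) (W1 : {vspace permMod F I1})
    (to2 : {action gT &-> I2}) (W2 : {vspace permMod F I2}) :=
  exists phi : 'Hom(permMod F I1, permMod F I2),
    [/\ {in W1 &, injective phi}, (phi @: W1)%VS = W2 &
        forall g, {in W1, forall f, phi (gtrans to1 g f) = gtrans to2 g (phi f)}].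

Definition orbit_span I (to : {action gT &-> I}) (f : permMod F I) :
    {vspace permMod F I} :=
  <<[seq gtrans to g f | g : gT]>>%VS.

End PermutationModules.

Section Specht.
Variables (F : fieldType) (v : nat) (la : seq nat).

(* la is meant to be a partition of v.  A tableau is a permutation T, where T x
   is the position of the entry x when the cells of the diagram of la are read
   row by row, starting from 0. *)
Definition tab_row (T : 'S_v) (x : 'I_v) : nat := reshape_index la (T x).
Definition tab_col (T : 'S_v) (x : 'I_v) : nat := reshape_offset la (T x).

(* A tabloid is recorded as the sequence of its row sets. *)
Definition tabloid_type := (size la).-tuple {set 'I_v}.

Definition tabloid (T : 'S_v) : tabloid_type :=
  [tuple [set x | tab_row T x == i] | i < size la].

Definition tabloid_act : {action 'S_v &-> tabloid_type} :=
  ('P^* * size la)%act.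

Definition column_stab (T : 'S_v) : {set 'S_v} :=
  [set s : 'S_v | [forall x, tab_col T (s x) == tab_col T x]].

Definition polytabloid (T : 'S_v) : permMod F tabloid_type :=
  \sum_(s in column_stab T)
    (-1) ^+ (odd_perm s) *: indic F [set tabloid_act (tabloid T) s].

Definition specht : {vspace permMod F tabloid_type} :=
  <<[seq polytabloid T | T : 'S_v]>>%VS.

End Specht.

(* The point set {1, ..., v} is 'I_v. *)
Definition block (v n : nat) := {B : {set 'I_v} | #|B| == n}.

Section Blocks.
Variables v n : nat.

Lemma card_block_act (B : block v n) (g : 'S_v) : #|('P^*)%act (val B) g| == n.
Proof. by rewrite card_setact (valP B). Qed.

Definition block_act_fun (B : block v n) (g : 'S_v) : block v n :=
  Sub (('P^*)%act (val B) g) (card_block_act B g).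

Lemma block_act1 : block_act_fun^~ 1%g =1 id.
Proof. by move=> B; apply: val_inj; rewrite /= act1. Qed.

Lemma block_actM B : act_morph block_act_fun B.
Proof. by move=> g h; apply: val_inj; rewrite /= actM. Qed.

Definition block_act : {action 'S_v &-> block v n} :=
  TotalAction block_act1 block_actM.

Definition is_design (t lam : nat) (D : {set block v n}) :=
  forall T : {set 'I_v}, #|T| = t -> #|[set B in D | T \subset val B]| = lam.

Definition design_span (F : fieldType) (D : {set block v n}) :
    {vspace permMod F (block v n)} :=
  orbit_span block_act (indic F D).

End Blocks.

Definition orthogonal_spaces (C : numClosedFieldType) (I : finType)
    (W1 W2 : {vspace permMod C I}) :=
  forall f h, f \in W1 -> h \in W2 -> \sum_x (f x : C) * (h x : C)^* = 0.

Definition two_row (v j : nat) : seq nat := [:: (v - j)%N; j].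

(* U_0, ..., U_n is the decomposition of C^X given by Young's rule *)
Record young_decomposition (C : numClosedFieldType) (v n : nat)
    (U : 'I_n.+1 -> {vspace permMod C (block v n)}) : Prop := {
  yd_irreducible : forall j : 'I_n.+1, irreducible_module (block_act v n) (U j);
  yd_orthogonal : forall i j : 'I_n.+1, i != j -> orthogonal_spaces (U i) (U j);
  yd_direct : directv (\sum_(j < n.+1) U j);
  yd_full : (\sum_(j < n.+1) U j)%VS = fullv;
  yd_non_iso : forall i j : 'I_n.+1, i != j ->
    ~ module_iso (block_act v n) (U i) (block_act v n) (U j);
  yd_specht : forall j : 'I_n.+1,
    module_iso (block_act v n) (U j)
      (tabloid_act v (two_row v j)) (specht C v (two_row v j));
  yd_unique : forall (j : 'I_n.+1) (W : {vspace permMod C (block v n)}),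
    submodule (block_act v n) W ->
    module_iso (block_act v n) W
      (tabloid_act v (two_row v j)) (specht C v (two_row v j)) ->
    W = U j
}.

(* Main.v *)
Require Import Defs.
From HB Require Import structures.
From mathcomp Require Import all_boot all_order all_algebra all_fingroup.
From mathcomp Require Import all_solvable.
From mathcomp Require Import reals complex.

Set Implicit Arguments.
Unset Strict Implicit.
Unset Printing Implicit Defensive.

Import Order.TTheory GRing.Theory Num.Theory.
Local Open Scope ring_scope.

(** Everything is done over an arbitrary numFieldType F; the theorem uses
    F = R[i] for the span and F = rat for the dimension.

    The model of U_j.  To a sequence p of j disjoint pairs (a_i, b_i) of points
    attach the function E_p(B) = prod_i ([a_i \in B] - [b_i \in B]) on
    n-subsets B, and let U_j be the span of all of them (young_space).  It is
    convenient to mix such products with inclusion conditions: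
    G_(p,S)(B) = E_p(B) [S \subset B] (pairprod), so that G_(nil,S) is the
    inclusion function of S.  Two identities carry the whole proof:
      G_((a,b)::p, S) = G_(p, a |: S) - G_(p, b |: S)      (pairprod_cons),
      sum_(b outside p and S) G_(p, b |: S) = (n - |p| - |S|) G_(p, S)
                                                     (sum_pairprod_setU1).
    Modulo the sum of the U_j the first identity makes G_(p, b |: S)
    independent of b, the second then expresses it by G_(p, S); by induction on
    S the inclusion functions of the n-subsets, which are the basis vectors,
    lie in the sum of the U_j (young_full).  Exchanging a and b for a pair
    (a, b) of p negates E_p and fixes the inclusion function of any set that
    avoids a and b; as E_q is a combination of inclusion functions of sets of
    size |q|, this makes U_i and U_j orthogonal for i <> j (young_orthogonal).

    Irreducibility.  A function that is negated by the exchange of every pair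
    of p and fixed by the transpositions of points outside p is a multiple of
    E_p (pairprod_unique).  Averaging over the permutations that send E_p to
    +E_p or -E_p, with that sign, therefore maps every f to a multiple of E_p,
    and this multiple is nonzero exactly when f is not orthogonal to E_p
    (sign_avg_pairprod).  So a submodule containing a function not orthogonal
    to E_p contains U_j (young_space_dichotomy), which is James' submodule
    theorem in this model.  Together with completeness and orthogonality it
    gives irreducibility; and since module maps commute with the averaging, it
    also gives the absence of isomorphisms between different U_j and the
    uniqueness of the copy of the Specht module.

    The Specht module.  Sending f to S |-> <f, [S \subset _]> on j-subsets S
    and then to tabloids is a module map.  The image of E_p and the polytabloid
    of the tableau whose columns are the pairs of p are both negated by the
    column transpositions, hence proportional (specht_map_pairprod,
    young_specht).  As dim U_j then depends on v and j only, completeness for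
    m-subsets gives sum_(j <= m) dim U_j = 'C(v, m), and the dimension formula.

    Designs.  Let f be the indicator of the design.  For |S| <= t the number
    <f, [S \subset _]> depends only on |S|, so f is orthogonal to
    U_1, ..., U_t (design_orthogonal).  For t < s <= n start from an s-subset S
    of a block and turn its elements one at a time into pairs: to replace a by
    a pair (a, b), pick b off all the blocks that meet the points used so far
    in at least t points.  There are boundedly many such blocks, so b exists
    for large v, and then <f, G_(p, b |: S)> = 0, so the scalar product with f
    stays what it was at the start: the number of blocks containing S
    (design_pairprod_extend).  Hence f is not orthogonal to U_s, and
    the span of its orbit contains U_s by the dichotomy. *)

(** * Linear algebra of permutation modules *)

Lemma span_ind (K : fieldType) (vT : vectType K) (P : vT -> Prop) (X : seq vT) :
    P 0 -> (forall a u w, P u -> P w -> P (a *: u + w)) ->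
    {in X, forall u, P u} -> {in <<X>>%VS, forall u, P u}.
Proof.
move=> P0 PD PX u Xu; rewrite (@coord_span _ _ _ (in_tuple X) u Xu).
apply: (big_ind P) => // [x y Px Py|i _].
  by rewrite -[x]scale1r; apply: PD.
rewrite -[_ *: _]addr0; apply: PD => //.
exact/PX/mem_nth.
Qed.

Section Functions.
Variables (gT : finGroupType) (F : numFieldType).
Implicit Types I : finType.

Fact gtrans_is_linear I (to : {action gT &-> I}) g :
  linear (@gtrans gT F I to g).
Proof. by move=> a f h; apply/ffunP=> x; rewrite !ffunE. Qed.
HB.instance Definition _ I (to : {action gT &-> I}) g :=
  GRing.isLinear.Build F (permMod F I) (permMod F I) *:%R
    (gtrans to g) (gtrans_is_linear to g).

Lemma gtrans_id I (to : {action gT &-> I}) (f : permMod F I) :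
  gtrans to 1%g f = f.
Proof. by apply/ffunP=> x; rewrite ffunE invg1 act1. Qed.

Lemma gtransM I (to : {action gT &-> I}) g h (f : permMod F I) :
  gtrans to (g * h)%g f = gtrans to h (gtrans to g f).
Proof. by apply/ffunP=> x; rewrite !ffunE invMg actM. Qed.

Lemma gtransK I (to : {action gT &-> I}) g (f : permMod F I) :
  gtrans to g^-1%g (gtrans to g f) = f.
Proof. by rewrite -gtransM mulgV gtrans_id. Qed.

Lemma gtrans_indic1 I (to : {action gT &-> I}) g x :
  gtrans to g (indic F [set x]) = indic F [set to x g].
Proof.
apply/ffunP=> y; rewrite !ffunE !inE; congr (nat_of_bool _)%:R.
by apply/eqP/eqP=> [<-|->]; rewrite ?actKV ?actK.
Qed.

Lemma span_submodule I (to : {action gT &-> I}) (X : seq (permMod F I)) :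
  (forall g, {in X, forall f, gtrans to g f \in <<X>>%VS}) ->
  submodule to <<X>>%VS.
Proof.
move=> XP g f; apply: (@span_ind _ _ (fun f => gtrans to g f \in <<X>>%VS)).
- by rewrite linear0 mem0v.
- by move=> a u w Xu Xw; rewrite linearP rpredD ?rpredZ.
by move=> u /(XP g).
Qed.

Lemma orbit_span_submodule I (to : {action gT &-> I}) (f : permMod F I) :
  submodule to (orbit_span to f).
Proof.
apply: span_submodule => g _ /imageP[h _ ->].
by rewrite -gtransM; apply/memv_span/image_f.
Qed.

Lemma mem_orbit_span I (to : {action gT &-> I}) (f : permMod F I) :
  f \in orbit_span to f.
Proof. by rewrite -{1}[f](gtrans_id to); apply/memv_span/image_f. Qed.

(** Bilinear, with no conjugation, so that one proof serves every F.  Over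
    R[i] it agrees with the Hermitian form when the second argument is one of
    the real-valued functions that span the U_j. *)
Definition dot I (f h : permMod F I) : F := \sum_x (f x : F) * (h x : F).

Lemma dotC I (f h : permMod F I) : dot f h = dot h f.
Proof. by apply: eq_bigr => x _; rewrite mulrC. Qed.

Fact dot_is_linear I (f : permMod F I) : scalar (dot f).
Proof.
move=> a u w; rewrite /dot mulr_sumr -big_split; apply: eq_bigr => x _ /=.
by rewrite !ffunE mulrDr; congr (_ + _); rewrite mulrCA.
Qed.
HB.instance Definition _ I (f : permMod F I) :=
  GRing.isLinear.Build F (permMod F I) F *%R (dot f) (dot_is_linear f).

Lemma dotZr I (a : F) (f h : permMod F I) : dot f (a *: h) = a * dot f h.
Proof. exact: linearZ. Qed.

Lemma dotZl I (a : F) (f h : permMod F I) : dot (a *: f) h = a * dot f h.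
Proof. by rewrite !(dotC _ h) dotZr. Qed.

Lemma dot_gtrans I (to : {action gT &-> I}) g (f h : permMod F I) :
  dot (gtrans to g f) h = dot f (gtrans to g^-1%g h).
Proof.
rewrite /dot (reindex_inj (act_inj to g)); apply: eq_bigr => x _.
by rewrite !ffunE actK invgK.
Qed.

Lemma dot_indic1 I (f : permMod F I) x : dot f (indic F [set x]) = f x.
Proof.
rewrite /dot (bigD1 x) //= ffunE inE eqxx mulr1 big1 ?addr0 // => y /negPf nyx.
by rewrite ffunE inE nyx mulr0.
Qed.

Lemma sum_indic I (f : permMod F I) :
  f = \sum_x (f x : F) *: indic F [set x].
Proof.
apply/ffunP=> y; rewrite sum_ffunE (bigD1 y) //= !ffunE inE eqxx big1 ?addr0.
  by rewrite /GRing.scale /= mulr1.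
by move=> x /negPf; rewrite eq_sym => nxy; rewrite !ffunE inE nxy scaler0.
Qed.

Lemma dim_permMod I : \dim (fullv : {vspace permMod F I}) = #|I|.
Proof. by rewrite dimvf /dim /= muln1. Qed.

End Functions.

(** * Products of pairs *)

Section PairProducts.
Variables (F : numFieldType) (v n : nat).
Local Notation pairs := (seq ('I_v * 'I_v)).
Local Notation M := (permMod F (block v n)).
Local Notation act := (block_act v n).
Implicit Types (p : pairs) (S : {set 'I_v}) (B : block v n) (f : M).

Definition points p := unzip1 p ++ unzip2 p.

(** The function G_(p,S).  Only the case where the points of p are distinct
    and outside S is of interest. *)
Definition pairprod p S : M :=
  [ffun B : block v n =>
     (\prod_(q <- p) ((q.1 \in val B)%:R - (q.2 \in val B)%:R))
       * (S \subset val B)%:R : F].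

Definition map_pairs (g : 'S_v) p := [seq (g q.1, g q.2) | q <- p].

Lemma points_map_pairs g p : points (map_pairs g p) = map g (points p).
Proof. by rewrite /points map_cat /unzip1 /unzip2 /map_pairs -!map_comp. Qed.

Lemma mem_block_act B (g : 'S_v) x :
  (x \in val (act B g)) = ((g^-1)%g x \in val B).
Proof.
rewrite /= setactE; apply/imsetP/idP=> [[y By ->]|Bx].
  by rewrite /aperm /= permK.
by exists ((g^-1)%g x); rewrite //= /aperm permKV.
Qed.

Lemma gtrans_pairprod g p S :
  gtrans act g (pairprod p S) = pairprod (map_pairs g p) (g @: S).
Proof.
apply/ffunP=> B; rewrite !ffunE big_map; congr (_ * _).
  by apply: eq_bigr => q _; rewrite !mem_block_act !invgK.
congr (nat_of_bool _)%:R; apply/subsetP/subsetP=> SB x Sx.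
  by case/imsetP: Sx => y /SB By ->; move: By; rewrite mem_block_act invgK.
by rewrite mem_block_act invgK SB ?imset_f.
Qed.

Lemma pairprod_cons a b p S :
  pairprod ((a, b) :: p) S = pairprod p (a |: S) - pairprod p (b |: S).
Proof.
apply/ffunP=> B; rewrite !ffunE big_cons /= !subUset !sub1set.
rewrite mulrAC -mulrBr mulrC; congr (_ * _).
by rewrite -!mulnb !natrM mulrBl.
Qed.

Lemma pairprod_perm p (q : pairs) S :
  perm_eq p q -> pairprod p S = pairprod q S.
Proof. by move=> pq; apply/ffunP=> B; rewrite !ffunE (perm_big _ pq). Qed.

Lemma points_cons a b p : perm_eq (points ((a, b) :: p)) (a :: b :: points p).
Proof.
rewrite /points /= perm_cons.
by rewrite -[b :: unzip2 p]cat1s perm_catCA.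
Qed.

Lemma uniq_points_cons a b p :
  uniq (points ((a, b) :: p)) =
  [&& a != b, a \notin points p, b \notin points p & uniq (points p)].
Proof.
by rewrite (perm_uniq (points_cons a b p)) /= inE negb_or -!andbA.
Qed.

Lemma points_perm p (q : pairs) : perm_eq p q -> perm_eq (points p) (points q).
Proof. by move=> pq; apply: perm_cat; apply: perm_map. Qed.

Lemma points_rem a b p : (a, b) \in p ->
  perm_eq p ((a, b) :: rem (a, b) p).
Proof. exact: perm_to_rem. Qed.

Lemma size_points p : size (points p) = (size p).*2.
Proof. by rewrite size_cat !size_map addnn. Qed.

Lemma mem_points1 a b p : (a, b) \in p -> (a \in points p) /\ (b \in points p).
Proof.
move=> pab; rewrite !mem_cat; split; apply/orP; [left|right].
  by apply/mapP; exists (a, b).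
by apply/mapP; exists (a, b).
Qed.

Lemma mem_pointsP x p :
  x \in points p -> exists a b, (a, b) \in p /\ (x = a \/ x = b).
Proof.
rewrite mem_cat => /orP[] /mapP[[a b] pab ->]; exists a, b; split => //=.
  by left.
by right.
Qed.

Lemma map_pairs_tperm_id x y p :
  x \notin points p -> y \notin points p -> map_pairs (tperm x y) p = p.
Proof.
move=> px py; rewrite -[RHS]map_id; apply/eq_in_map=> -[a b] /mem_points1[pa pb].
by rewrite !tpermD //=; [apply: contraNneq px => -> | apply: contraNneq py => ->
  | apply: contraNneq px => -> | apply: contraNneq py => ->].
Qed.

(** Only the factor of (a, b) is affected, because the points of p are
    distinct; it is negated. *)
Lemma gtrans_pair_swap a b p : uniq (points p) -> (a, b) \in p ->
  gtrans act (tperm a b) (pairprod p set0) = - pairprod p set0.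
Proof.
move=> Up /points_rem Ep.
have := Up; rewrite (perm_uniq (points_perm Ep)) uniq_points_cons.
case/and4P=> nab na nb _; rewrite (pairprod_perm _ Ep) gtrans_pairprod /=.
rewrite map_pairs_tperm_id // tpermL tpermR imset0.
by rewrite !pairprod_cons opprB.
Qed.

Lemma gtrans_pair_fix x y p : x \notin points p -> y \notin points p ->
  gtrans act (tperm x y) (pairprod p set0) = pairprod p set0.
Proof.
by move=> px py; rewrite gtrans_pairprod map_pairs_tperm_id // imset0.
Qed.

Lemma pairprod_neq0 p S B :
  (pairprod p S B != 0) =
  (S \subset val B) && all (fun q => (q.1 \in val B) != (q.2 \in val B)) p.
Proof.
rewrite ffunE mulf_eq0 negb_or andbC pnatr_eq0 eqb0 negbK; congr (_ && _).
rewrite prodf_seq_neq0; apply: eq_all => q /=.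
by case: (_ \in _); case: (_ \in _);
  rewrite ?subrr ?eqxx ?subr0 ?sub0r ?oppr_eq0 ?oner_eq0.
Qed.

(** The only values are 0, 1 and -1. *)
Lemma pairprod_sqr p S B :
  (pairprod p S B : F) * pairprod p S B = (pairprod p S B != 0)%:R.
Proof.
rewrite pairprod_neq0 ffunE mulrACA -natrM mulnb andbb mulrC -mulnb natrM.
congr (_ * _); rewrite -big_split /=.
elim: p => [|q p IHp]; rewrite ?big_nil ?big_cons //= IHp -mulnb natrM.
congr (_ * _).
by case: (_ \in _); case: (_ \in _);
  rewrite ?subrr ?mulr0 ?subr0 ?sub0r ?mulrNN ?mulr1.
Qed.

(** A block on which a product of pairs does not vanish contains exactly one
    point of each pair. *)
Lemma count_points (A : {pred 'I_v}) p :
  all (fun q => (q.1 \in A) != (q.2 \in A)) p ->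
  count [in A] (points p) = size p.
Proof.
elim: p => [//|[a b] p IHp].
rewrite (seq.permP (points_cons a b p)) /= => /andP[ab /IHp <-].
by move: ab; case: (a \in A); case: (b \in A).
Qed.

Lemma card_points_count (A : {set 'I_v}) p : uniq (points p) ->
  #|A :&: [set x in points p]| = count [in A] (points p).
Proof.
move=> Up; rewrite -size_filter -(card_uniqP (filter_uniq _ Up)).
by apply: eq_card => x; rewrite !inE mem_filter.
Qed.

End PairProducts.

(** * The spaces U_j: completeness and orthogonality *)

Lemma disjoint_setU1 (T : finType) (a : T) (A : {set T}) (B : {pred T}) :
  [disjoint a |: A & B] = (a \notin B) && [disjoint A & B].
Proof. by rewrite -disjointU1; apply: eq_disjoint => x; rewrite !inE. Qed.

Section YoungSpaces.
Variables (F : numFieldType) (v n : nat).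
Local Notation pairs := (seq ('I_v * 'I_v)).
Local Notation M := (permMod F (block v n)).
Local Notation act := (block_act v n).
Local Notation pp := (pairprod F n).
Implicit Types (p : pairs) (S : {set 'I_v}) (B : block v n) (f : M).

Lemma pairprod_setU1 p b S B :
  pp p (b |: S) B = (pp p S B : F) * (b \in val B)%:R.
Proof. by rewrite !ffunE subUset sub1set -mulnb natrM mulrA mulrAC. Qed.

(** Where G_(p,S) does not vanish, B contains S and exactly one point of each
    pair, so n - |p| - |S| of its points remain for b. *)
Lemma sum_pairprod_setU1 p S :
    uniq (points p) -> [disjoint S & points p] ->
  \sum_(b | (b \notin points p) && (b \notin S)) pp p (b |: S)
    = (n - (size p + #|S|))%:R *: pp p S.
Proof.
move=> Up dSp; apply/ffunP=> B; rewrite sum_ffunE [RHS]ffunE.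
under eq_bigr do rewrite pairprod_setU1.
rewrite -mulr_sumr mulrC.
have [->|] := eqVneq (pp p S B) 0; first by rewrite scaler0 mulr0.
rewrite pairprod_neq0 => /andP[SB /(count_points (A := val B)) pB].
congr (_ * _); rewrite -natr_sum; congr _%:R.
rewrite (eq_bigr (fun b => if b \in val B then 1 else 0)%N) //.
rewrite -big_mkcondr /= sum1_card -pB -card_points_count // -cardsUI.
rewrite (_ : _ :&: S = set0) ?cards0 ?addn0; last first.
  apply/setP=> x; rewrite !inE.
  have [Sx|_] := boolP (x \in S); last by rewrite andbF.
  by rewrite (disjointFr dSp Sx) andbF.
have {2}-> : n = #|val B| by rewrite (eqP (valP B)).
rewrite -(cardsID (val B :&: [set x in points p] :|: S) (val B)).
rewrite (setIidPr _) ?subUset ?subsetIl ?SB // addKn.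
apply: eq_card => x; rewrite !inE unfold_in /=.
have [Sx|_] := boolP (x \in S); first by rewrite orbT andbF.
by case: (x \in sval B); case: (x \in points p).
Qed.

Definition pairing j := [pred p : j.-tuple ('I_v * 'I_v) | uniq (points p)].

Definition young_space j : {vspace M} :=
  <<[seq pp p set0 | p : j.-tuple _ in pairing j]>>%VS.

Lemma mem_young_space p :
  uniq (points p) -> pp p set0 \in young_space (size p).
Proof. by move=> Up; apply/memv_span/imageP; exists (in_tuple p). Qed.

Lemma young_space_ind (j : nat) (P : M -> Prop) :
    P 0 -> (forall a u w, P u -> P w -> P (a *: u + w)) ->
    (forall p, uniq (points p) -> size p = j -> P (pp p set0)) ->
  {in young_space j, forall f, P f}.
Proof.
move=> P0 PD Pp; apply: span_ind => // _ /imageP[p Up ->].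
by apply: Pp; rewrite ?size_tuple.
Qed.

Lemma young_space_dot0 j f :
    (forall p, uniq (points p) -> size p = j -> dot f (pp p set0) = 0) ->
  {in young_space j, forall h, dot f h = 0}.
Proof.
move=> fp; apply: young_space_ind => // [|a u w hu hw]; first exact: linear0.
by rewrite linearP /= hu hw mulr0 addr0.
Qed.

(** With a in S and S' = S :\ a, the functions G_(p, b |: S') for b outside
    p and S' differ from G_(p,S) by functions G_((a,b)::p, S') with a smaller
    set; their sum is a multiple of G_(p,S').  By induction on the set, a
    multiple of G_(p,S) lies in the sum, with as factor the number of possible
    b, which is nonzero because b = a is one of them. *)
Lemma pairprod_full p S :
    uniq (points p) -> [disjoint S & points p] -> (size p + #|S| <= n)%N ->
  pp p S \in (\sum_(j < n.+1) young_space j)%VS.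
Proof.
set V := (\sum_(j < _) _)%VS.
have [m] := ubnP #|S|; elim: m => // m IHm in p S *.
rewrite ltnS => leSm Up dSp len.
have [->|[a Sa]] := set_0Vmem S.
  have ltp: (size p < n.+1)%N by rewrite ltnS (leq_trans (leq_addr _ _) len).
  apply: (subvP (sumv_sup (Ordinal ltp) _ (subvv _))) => //.
  exact: mem_young_space.
pose S' := S :\ a; have defS : S = a |: S' by rewrite setD1K.
have cS : #|S| = #|S'|.+1 by rewrite (cardsD1 a) Sa.
have dS'p : [disjoint S' & points p].
  by apply: disjointWl dSp; apply/subsetP=> x /setD1P[].
have pa : a \notin points p by rewrite (disjointFr dSp Sa).
have lenS' : (size p + #|S'| < n)%N by rewrite -addnS -cS.
have S'm : (#|S'| < m)%N by rewrite -cS.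
pose Z b := (b \notin points p) && (b \notin S').
have E : \sum_(b | Z b) pp p (b |: S') = _ := sum_pairprod_setU1 Up dS'p.
have Za : Z a by rewrite /Z pa !inE eqxx.
have step b : Z b -> b != a -> pp p (b |: S') - pp p S \in V.
  move=> /andP[pb S'b] nba; rewrite {1}defS -pairprod_cons.
  apply: IHm => //.
    by rewrite uniq_points_cons nba pb pa.
  rewrite (eq_disjoint_r (perm_mem (points_cons b a p))).
    rewrite disjoint_sym disjoint_cons S'b /= disjoint_cons.
    by rewrite !inE eqxx /= disjoint_sym.
have: #|Z|%:R *: pp p S \in V.
  rewrite -[_ *: _](subrK (\sum_(b | Z b) pp p (b |: S'))) E memvD //.
    rewrite -E -sumr_const scaler_suml -sumrB rpred_sum // => b Zb.
    rewrite scale1r -opprB rpredN.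
    have [->|] := eqVneq b a; first by rewrite -defS subrr rpred0.
    exact: step.
  by rewrite rpredZ // IHm // ltnW.
move/(rpredZ (#|Z|%:R^-1)); rewrite scalerA mulVf ?scale1r //.
by rewrite pnatr_eq0 -lt0n; apply/card_gt0P; exists a.
Qed.

(** The functions G_(nil,B) with |B| = n are the basis vectors. *)
Lemma young_full : (\sum_(j < n.+1) young_space j)%VS = fullv.
Proof.
apply/vspaceP=> f; rewrite memvf [f]sum_indic rpred_sum // => B _.
rewrite rpredZ // (_ : indic F [set B] = pp [::] (val B)).
  by apply: pairprod_full; rewrite ?(eqP (valP B)) //= disjoint_sym disjoint0.
apply/ffunP=> B'; rewrite !ffunE big_nil mul1r inE; congr (nat_of_bool _)%:R.
rewrite -(inj_eq val_inj) eq_sym eqEcard (eqP (valP B)) (eqP (valP B')) leqnn.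
by rewrite andbT.
Qed.

(** A difference of two inclusion functions of k-sets is already orthogonal
    to f, and G_(p,S) is a sum of such differences when p is not empty.  Used
    with c = 0 and with the constant block counts of a design. *)
Lemma dot_pairprod_const k f c :
    (forall S, #|S| = k -> dot f (pp [::] S) = c) ->
  forall p S, uniq (points p) -> [disjoint S & points p] ->
    (size p + #|S|)%N = k ->
  dot f (pp p S) = if p is [::] then c else 0.
Proof.
move=> fS; elim=> [|[a b] p IHp] S; first by move=> _ _ /fS.
rewrite uniq_points_cons => /and4P[nab pa pb Up].
rewrite (eq_disjoint_r (perm_mem (points_cons a b p))).
rewrite disjoint_sym disjoint_cons disjoint_cons => /and3P[Sa Sb dpS] cS.
rewrite pairprod_cons linearB /= !IHp ?subrr //.
- by rewrite disjoint_setU1 pb disjoint_sym.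
- by rewrite cardsU1 Sb add1n addnS.
- by rewrite disjoint_setU1 pa disjoint_sym.
by rewrite cardsU1 Sa add1n addnS.
Qed.

(** Some pair of p avoids S.  Its exchange negates E_p and fixes the
    inclusion function of S, so their scalar product is its own opposite. *)
Lemma dot_pairprod_small p S :
    uniq (points p) -> (#|S| < size p)%N -> dot (pp p set0) (pp [::] S) = 0.
Proof.
move=> Up ltSp.
have /hasP[[a b] pab] : has (fun q => (q.1 \notin S) && (q.2 \notin S)) p.
  apply: contraLR ltSp; rewrite -leqNgt -all_predC => /allP hp.
  apply: (@leq_trans #|S :&: [set x in points p]|); last first.
    by rewrite subset_leq_card ?subsetIl.
  rewrite card_points_count //; elim: p {Up} hp => // -[a b] p IHp hp.
  rewrite (seq.permP (points_cons a b p)) /=.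
  have := hp (a, b) (mem_head _ _); rewrite /= negb_and !negbK.
  have: (size p <= count [in S] (points p))%N.
    by apply: IHp => x px; apply: hp; rewrite inE px orbT.
  by case: (a \in S); case: (b \in S) => //= le _; rewrite ?add1n ?add0n ltnS ?leqW.
case/andP=> /= Sa Sb.
have fixS : gtrans act (tperm a b) (pp [::] S) = pp [::] S.
  rewrite gtrans_pairprod /=; congr pairprod.
  rewrite -[RHS]imset_id; apply: eq_in_imset => x Sx; rewrite tpermD //.
    by apply: contraNneq Sa => ->.
  by apply: contraNneq Sb => ->.
have := dot_gtrans act (tperm a b) (pp p set0) (pp [::] S).
rewrite tpermV fixS gtrans_pair_swap // -scaleN1r dotZl mulN1r => /eqP.
by rewrite eq_sym -subr_eq0 opprK -mulr2n mulrn_eq0 /= => /eqP.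
Qed.
End YoungSpaces.

(** * Functions with the symmetries of a product of pairs *)

Section Uniqueness.
Variables (F : numFieldType) (v n : nat).
Local Notation pairs := (seq ('I_v * 'I_v)).
Local Notation M := (permMod F (block v n)).
Local Notation act := (block_act v n).
Local Notation pp := (pairprod F n).
Implicit Types (p : pairs) (S : {set 'I_v}) (B : block v n) (f : M).

Lemma card_block B : #|val B| = n.
Proof. exact: eqP (valP B). Qed.

Lemma mem_act_tperm B x y z :
  (z \in val (act B (tperm x y))) = (tperm x y z \in val B).
Proof. by rewrite mem_block_act tpermV. Qed.

(** The measure of the induction in pairprod_unique: exchanging x and y brings
    A closer to A'. *)
Lemma card_swapD (A A' C : {set 'I_v}) x y :
    (forall z, (z \in C) = (tperm x y z \in A)) ->
    x \in A -> x \notin A' -> y \notin A -> y \in A' ->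
  (#|C :\: A'| < #|A :\: A'|)%N.
Proof.
move=> CE Ax A'x Ay A'y; apply: proper_card; apply/properP; split; last first.
  by exists x; rewrite !inE ?A'x ?Ax // CE tpermL (negPf Ay).
apply/subsetP=> z; rewrite !inE CE => /andP[A'z].
case: tpermP => [->|zy|_ _ ->]; rewrite ?A'z //; first by rewrite (negPf Ay).
by rewrite zy A'y in A'z.
Qed.

Lemma swap_value f a b B :
  gtrans act (tperm a b) f = - f -> f (act B (tperm a b)) = - f B.
Proof.
move/ffunP/(_ (act B (tperm a b))); rewrite !ffunE actK => ->.
by rewrite opprK.
Qed.

(** Such an f vanishes where E_p does, because the exchange of a pair with
    both or no point in B fixes B.  Any two blocks where E_p does not vanish
    are joined by transpositions of the two kinds, and along each of them f
    and E_p change by the same sign. *)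
Lemma pairprod_unique p f :
    uniq (points p) ->
    (forall a b, (a, b) \in p -> gtrans act (tperm a b) f = - f) ->
    (forall x y B, x \notin points p -> y \notin points p ->
       pp p set0 B != 0 -> x \in val B -> y \notin val B ->
       f (act B (tperm x y)) = f B) ->
  exists c : F, f = c *: pp p set0.
Proof.
move=> Up fswap ffix; pose E := pp p set0.
have E0 B : E B = 0 -> f B = 0.
  move/eqP; apply: contraTeq => fB; rewrite pairprod_neq0 sub0set.
  apply/allP=> -[a b] pab; apply: contraNneq fB => /= abB.
  have fixB : act B (tperm a b) = B.
    apply/val_inj/setP=> z; rewrite mem_act_tperm.
    by case: tpermP => // ->; rewrite abB.
  have := swap_value B (fswap _ _ pab); rewrite fixB => /esym/eqP.
  by rewrite eqNr.
have key B B' : E B != 0 -> E B' != 0 ->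
    (f B : F) * (E B' : F) = (f B' : F) * (E B : F).
  have [m] := ubnP #|val B :\: val B'|; elim: m => // m IHm in B *.
  rewrite ltnS => leBm EB EB'.
  have cBB' : #|val B| = #|val B'| by rewrite !card_block.
  have pB a b : (a, b) \in p -> (a \in val B) != (b \in val B).
    by move: EB; rewrite pairprod_neq0 => /andP[_ /allP pB] /pB.
  have pB' a b : (a, b) \in p -> (a \in val B') != (b \in val B').
    by move: EB'; rewrite pairprod_neq0 => /andP[_ /allP pB'] /pB'.
  (* Either B and B' choose differently in some pair, which is then exchanged
     in B, or they agree on p and differ in two points outside p. *)
  have [/hasP[[a b] pab /= ab]|] :=
      boolP (has (fun q => (q.1 \in val B) != (q.1 \in val B')) p).
    have fE := swap_value B (fswap _ _ pab).
    have EE : E (act B (tperm a b)) = - E B.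
      exact: swap_value (gtrans_pair_swap F n Up pab).
    have lt : (#|val (act B (tperm a b)) :\: val B'| < m)%N.
      apply: leq_trans leBm; move: (pB _ _ pab) (pB' _ _ pab) ab.
      have [Ba|Ba] := boolP (a \in val B); have [Bb|Bb] := boolP (b \in val B);
      have [B'a|B'a] := boolP (a \in val B') => //;
      have [B'b|B'b] := boolP (b \in val B') => // _ _ _.
        by apply: card_swapD Ba B'a Bb B'b => z; rewrite mem_act_tperm.
      by apply: card_swapD Bb B'b Ba B'a => z; rewrite mem_act_tperm tpermC.
    have := IHm _ lt; rewrite fE EE oppr_eq0 mulNr mulrN => /(_ EB EB').
    by move/oppr_inj.
  rewrite -all_predC => /allP agree.
  have same x : x \in points p -> (x \in val B) = (x \in val B').
    move=> /mem_pointsP[a [b [pab xab]]].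
    have /= := agree _ pab; rewrite negbK => /eqP aE.
    case: xab => ->; first exact: aE.
    move: (pB _ _ pab) (pB' _ _ pab); rewrite aE.
    by case: (a \in _); case: (b \in _); case: (b \in _).
  have [/eqP|[x]] := set_0Vmem (val B :\: val B').
    rewrite setD_eq0 => sBB'; suff -> : B = B' by [].
    by apply/val_inj/eqP; rewrite eqEcard sBB' cBB' /=.
  rewrite inE => /andP[B'x Bx].
  have /card_gt0P[y] : (0 < #|val B' :\: val B|)%N.
    rewrite cardsD setIC -cBB' -cardsD; apply/card_gt0P; exists x.
    by rewrite inE B'x.
  rewrite inE => /andP[By B'y].
  have px : x \notin points p by apply: contra B'x => /same <-.
  have py : y \notin points p by apply: contra By => /same ->.
  have EE : E (act B (tperm x y)) = E B.
    have /ffunP/(_ (act B (tperm x y))) := gtrans_pair_fix F n px py.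
    by rewrite ffunE actK => <-.
  have lt : (#|val (act B (tperm x y)) :\: val B'| < m)%N.
    apply: leq_trans leBm.
    by apply: card_swapD Bx B'x By B'y => z; rewrite mem_act_tperm.
  by have := IHm _ lt; rewrite ffix // EE; apply.
have [B0 EB0|E_0] := pickP (fun B => E B != 0); last first.
  exists 0; rewrite scale0r; apply/ffunP=> B; rewrite [RHS]ffunE E0 //.
  exact/eqP/negbFE/E_0.
exists ((f B0 : F) / (E B0 : F)); apply/ffunP=> B; rewrite [RHS]ffunE.
have [EB|EB] := eqVneq (E B) 0; first by rewrite (E0 _ EB) -/E EB scaler0.
apply: (mulIf EB0); rewrite key // -/E /GRing.scale /=.
by rewrite mulrAC divfK.
Qed.
End Uniqueness.

(** * Signed averages and submodules *)

Section SignCharacter.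
Variables (gT : finGroupType) (F : numFieldType) (I0 : finType).
Variables (to0 : {action gT &-> I0}) (E : permMod F I0).

(** The sign by which s acts on E, and 0 when s sends E to neither E nor -E.
    Taking the whole stabiliser of {E, -E} avoids describing it by pairs: the
    averages inherit every symmetry and antisymmetry of E. *)
Definition stab_sign (s : gT) : F :=
  (gtrans to0 s E == E)%:R - (gtrans to0 s E == - E)%:R.

(** An element of the group algebra, so that it acts on every permutation
    module of the group, not only on the one that contains E. *)
Definition sign_avg (I : finType) (to : {action gT &-> I}) (f : permMod F I) :
    permMod F I :=
  \sum_s stab_sign s *: gtrans to s f.

Definition sign_weight : F := \sum_s stab_sign s * stab_sign s.

Hypothesis E_neq0 : E != 0.

Lemma vect_oppr_neq : (E == - E) = false.
Proof.
apply: contraNF E_neq0 => /eqP/ffunP EN; apply/eqP/ffunP=> x.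
have /esym/eqP := EN x; rewrite !ffunE => EN'; apply/eqP.
by rewrite -eqNr.
Qed.

Variant stab_sign_spec s : F -> Prop :=
| StabPlus of gtrans to0 s E = E : stab_sign_spec s 1
| StabMinus of gtrans to0 s E = - E : stab_sign_spec s (-1)
| StabZero : stab_sign_spec s 0.

Lemma stab_signP s : stab_sign_spec s (stab_sign s).
Proof.
rewrite /stab_sign; have [sE|_] := eqVneq (gtrans to0 s E) E.
  by rewrite sE vect_oppr_neq subr0; constructor.
have [sE|_] := eqVneq (gtrans to0 s E) (- E).
  by rewrite sub0r; constructor.
by rewrite subrr; constructor.
Qed.

Lemma stab_sign_fix u s : gtrans to0 u E = E ->
  stab_sign (s * u)%g = stab_sign s.
Proof.
move=> uE; rewrite /stab_sign gtransM.
have inj := inj_eq (can_inj (gtransK (F := F) to0 u)).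
have uE' : gtrans to0 u (- E) = - E by rewrite linearN /= uE.
by rewrite -(inj (gtrans to0 s E) E) -(inj (gtrans to0 s E) (- E)) uE uE'.
Qed.

Lemma stab_sign_opp u s : gtrans to0 u E = - E ->
  stab_sign (s * u)%g = - stab_sign s.
Proof.
move=> uE; rewrite /stab_sign gtransM.
have uE' : gtrans to0 u (- E) = E by rewrite linearN /= uE opprK.
have inj := inj_eq (can_inj (gtransK (F := F) to0 u)).
by rewrite -(inj (gtrans to0 s E) E) -(inj (gtrans to0 s E) (- E)) uE uE' opprB.
Qed.

Lemma sign_avg_fix (I : finType) (to : {action gT &-> I}) u f :
  gtrans to0 u E = E -> gtrans to u (sign_avg to f) = sign_avg to f.
Proof.
move=> uE; rewrite /sign_avg linear_sum /= [RHS](reindex_inj (mulIg u)) /=.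
by apply: eq_bigr => s _; rewrite linearZ /= gtransM stab_sign_fix.
Qed.

Lemma sign_avg_opp (I : finType) (to : {action gT &-> I}) u f :
  gtrans to0 u E = - E -> gtrans to u (sign_avg to f) = - sign_avg to f.
Proof.
move=> uE; rewrite /sign_avg linear_sum /= [X in - X](reindex_inj (mulIg u)) /=.
rewrite -sumrN; apply: eq_bigr => s _.
by rewrite linearZ /= gtransM stab_sign_opp // scaleNr opprK.
Qed.

Lemma sign_avg_self : sign_avg to0 E = sign_weight *: E.
Proof.
rewrite /sign_avg /sign_weight scaler_suml; apply: eq_bigr => s _.
case: stab_signP => [->|->|];
  rewrite ?mulr1 ?mulrNN ?mulr0 ?scaleNr ?scalerN ?opprK //.
  by rewrite mulr1.
by rewrite !scale0r.
Qed.

Lemma dot_sign_avg f : dot (sign_avg to0 f) E = sign_weight * dot f E.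
Proof.
rewrite dotC linear_sum mulr_suml /=; apply: eq_bigr => s _.
rewrite linearZ /= dotC dot_gtrans.
case: stab_signP => [sE|sE|]; last by rewrite !mul0r.
  by rewrite -{1}sE gtransK mulr1.
have {1}-> : E = gtrans to0 s (- E) by rewrite linearN /= sE opprK.
by rewrite gtransK linearN /= mulrNN mul1r mulrNN !mul1r.
Qed.

Lemma sign_weight_neq0 : sign_weight != 0.
Proof.
apply: lt0r_neq0; rewrite /sign_weight (bigD1 1%g) //=.
rewrite ltr_wpDr //.
  apply: sumr_ge0 => s _; by case: stab_signP; rewrite ?mulr0 ?mulrNN ?mulr1.
by rewrite /stab_sign gtrans_id eqxx vect_oppr_neq subr0 mulr1.
Qed.

Lemma sign_avg_submodule (I : finType) (to : {action gT &-> I})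
    (W : {vspace permMod F I}) f :
  submodule to W -> f \in W -> sign_avg to f \in W.
Proof. by move=> sW Wf; apply: rpred_sum => s _; rewrite rpredZ // sW. Qed.

(** This transports the action of the averaging element between a space U_j,
    an isomorphic submodule and the Specht module. *)
Lemma sign_avg_hom (I1 I2 : finType)
    (to1 : {action gT &-> I1}) (to2 : {action gT &-> I2})
    (W : {vspace permMod F I1}) (phi : 'Hom(permMod F I1, permMod F I2)) :
  (forall g, {in W, forall f, phi (gtrans to1 g f) = gtrans to2 g (phi f)}) ->
  {in W, forall f, phi (sign_avg to1 f) = sign_avg to2 (phi f)}.
Proof.
move=> phiG f Wf; rewrite linear_sum; apply: eq_bigr => s _.
by rewrite linearZ /= phiG.
Qed.

End SignCharacter.

Section Dichotomy.
Variables (F : numFieldType) (v n : nat).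
Local Notation pairs := (seq ('I_v * 'I_v)).
Local Notation M := (permMod F (block v n)).
Local Notation act := (block_act v n).
Local Notation pp := (pairprod F n).
Local Notation U := (young_space F v n).
Implicit Types (p : pairs) (S : {set 'I_v}) (B : block v n) (f : M).

Lemma dot_pairprod_self p : pp p set0 != 0 -> dot (pp p set0) (pp p set0) != 0.
Proof.
apply: contraNneq; rewrite /dot; under eq_bigr do rewrite pairprod_sqr.
rewrite -natr_sum => /eqP; rewrite pnatr_eq0 sum_nat_eq0 => /forallP E0.
apply/eqP/ffunP=> B; rewrite [RHS]ffunE; apply/eqP.
by have := E0 B; rewrite /= eqb0 negbK.
Qed.

(** The average of f has the symmetries of E_p, so pairprod_unique applies;
    the multiple is found by taking scalar products with E_p. *)
Lemma sign_avg_pairprod p f : uniq (points p) -> pp p set0 != 0 ->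
  exists c : F, sign_avg act (pp p set0) act f = c *: pp p set0 /\
    c * dot (pp p set0) (pp p set0) =
      sign_weight act (pp p set0) * dot f (pp p set0).
Proof.
move=> Up E0.
pose Ef := sign_avg act (pp p set0) act f.
have [|x y B px py _ Bx By|c Ec] := @pairprod_unique F v n p Ef Up.
- by move=> a b pab; apply: sign_avg_opp => //; apply: gtrans_pair_swap.
- have := sign_avg_fix act f (gtrans_pair_fix F n px py).
  move/ffunP/(_ (act B (tperm x y))).
  by rewrite ffunE actK => <-.
by exists c; split=> //; rewrite -dotZl -Ec dot_sign_avg.
Qed.

(** The symmetric group is transitive on sequences of distinct points, so one
    function E_p generates all of U_j. *)
Lemma map_pairs_trans p (q : pairs) : uniq (points p) -> uniq (points q) ->
  size p = size q -> exists g, map_pairs g p = q.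
Proof.
move=> Up Uq pq.
have sz : (size (points p) <= #|'I_v|)%N by rewrite -(card_uniqP Up) max_card.
have tr := ntransitive_weak sz (Sym_trans 'I_v).
have spq : size (points q) == size (points p) by rewrite !size_points pq.
have Dp : in_tuple (points p) \in dtuple_on (size (points p)) [set: 'I_v].
  by rewrite inE /= Up; apply/subsetP=> x; rewrite inE.
have Dq : Tuple spq \in dtuple_on (size (points p)) [set: 'I_v].
  by rewrite inE /= Uq; apply/subsetP=> x; rewrite inE.
have [g _ /(congr1 val) /= E] := atransP2 tr Dp Dq.
exists g; move: E; rewrite /points map_cat => /eqP.
rewrite eqseq_cat ?size_map // => /andP[/eqP E1 /eqP E2].
have sp : size (unzip1 p) = size (unzip2 p) by rewrite !size_map.
rewrite -[RHS]zip_unzip E1 E2 /map_pairs.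
by elim: (p) => //= -[a b] r ->.
Qed.

Lemma young_space_submodule j : submodule act (U j).
Proof.
apply: span_submodule => g _ /imageP[p Up ->].
rewrite gtrans_pairprod imset0.
rewrite -[in X in _ \in X](size_tuple p) -(size_map (fun q => (g q.1, g q.2))).
apply: mem_young_space; rewrite points_map_pairs map_inj_uniq //.
exact: perm_inj.
Qed.

Lemma young_space_sub p (W : {vspace M}) : uniq (points p) ->
  submodule act W -> pp p set0 \in W -> (U (size p) <= W)%VS.
Proof.
move=> Up sW Wp; apply/span_subvP => _ /imageP[q Uq ->].
have [|g <-] := map_pairs_trans Up Uq; first by rewrite size_tuple.
by rewrite -(imset0 g) -gtrans_pairprod sW.
Qed.

(** James' submodule theorem: the signed average of f is a nonzero multiple
    of E_p and lies in W, and the translates of E_p span U_j. *)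
Lemma young_space_dichotomy p f (W : {vspace M}) : uniq (points p) ->
  submodule act W -> f \in W -> dot f (pp p set0) != 0 -> (U (size p) <= W)%VS.
Proof.
move=> Up sW Wf fE0.
have E0 : pp p set0 != 0 by apply: contraNneq fE0 => ->; rewrite linear0.
have [c [Ec cN]] := sign_avg_pairprod f Up E0.
apply: young_space_sub => //.
have c0 : c != 0.
  apply: contraTneq (mulf_neq0 (sign_weight_neq0 act E0) fE0) => c0.
  by rewrite -cN c0 mul0r eqxx.
rewrite -[pp p set0](scalerK c0) -Ec rpredZ //.
exact: sign_avg_submodule.
Qed.

Lemma young_orthogonal i j f h :
  i != j -> f \in U i -> h \in U j -> dot f h = 0.
Proof.
wlog lij : i j f h / (i < j)%N.
  move=> IH; rewrite neq_ltn => /orP[lij|lji] fi hj.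
    by apply: (IH _ _ _ _ lij _ fi hj); rewrite neq_ltn lij.
  by rewrite dotC; apply: (IH _ _ _ _ lji _ hj fi); rewrite neq_ltn lji.
move=> _ fi hj; rewrite dotC.
apply: young_space_dot0 fi => p Up pi; rewrite dotC.
apply: young_space_dot0 hj => q Uq qj; rewrite dotC.
rewrite (dot_pairprod_const (k := i) (c := 0)) //.
- by case: (p).
- by move=> S cS; apply: dot_pairprod_small; rewrite // cS qj.
- by apply: eq_disjoint0 => x; rewrite inE.
by rewrite cards0 addn0.
Qed.

(** Completeness turned around; with orthogonality it replaces any use of
    positivity of the bilinear form, which fails over R[i]. *)
Lemma young_nondegenerate f :
  (forall j : 'I_n.+1, {in U j, forall h, dot f h = 0}) -> f = 0.
Proof.
move=> fU; have f0 h : dot f h = 0.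
  have : h \in (\sum_(j < n.+1) U j)%VS by rewrite young_full memvf.
  case/memv_sumP=> u uU ->; rewrite linear_sum big1 // => j _.
  exact/fU/uU.
by apply/ffunP=> B; rewrite -dot_indic1 f0 ffunE.
Qed.

Lemma young_independent (P : pred 'I_n.+1) :
  directv (\sum_(j < n.+1 | P j) U j)%VS.
Proof.
apply/directv_sum_independent => us usU us0 i Pi.
apply: young_nondegenerate => k h hk.
have [ki|nki] := eqVneq k i; last first.
  by apply: young_orthogonal (usU _ Pi) hk; rewrite eq_sym.
have -> : us i = - \sum_(j < n.+1 | P j && (j != i)) us j.
  by apply/eqP; move/eqP: us0; rewrite (bigD1 i) //= addr_eq0.
rewrite dotC linearN linear_sum big1 ?oppr0 //= => j /andP[Pj nji].
by rewrite dotC; apply: young_orthogonal (usU _ Pj) hk; rewrite ki.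
Qed.

End Dichotomy.

(** * Tabloids of two-row shape as sets of size j *)

Lemma subset_of_card (T : finType) (A : {set T}) k : (k <= #|A|)%N ->
  exists2 C : {set T}, C \subset A & #|C| = k.
Proof.
move=> kA; have : (0 < #|[set C : {set T} | C \subset A & #|C| == k]|)%N.
  by rewrite cards_draws bin_gt0.
by case/card_gt0P=> C; rewrite inE => /andP[CA /eqP]; exists C.
Qed.

Lemma set_between (T : finType) (A B : {set T}) k : A \subset B ->
  (#|A| <= k <= #|B|)%N ->
  exists C : {set T}, [/\ A \subset C, C \subset B & #|C| = k].
Proof.
move=> AB /andP[Ak kB].
have [|C CBA cC] := @subset_of_card _ (B :\: A) (k - #|A|).
  by rewrite cardsD (setIidPr AB) leq_sub2r.
move: CBA; rewrite subsetD => /andP[CB dCA]; exists (A :|: C); split.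
- exact: subsetUl.
- by rewrite subUset AB.
by rewrite cardsU (disjoint_setI0 _) ?cards0 ?subn0 ?cC ?subnKC // disjoint_sym.
Qed.

(** A witness: a block containing every first point and no second point. *)
Lemma pairprod_nonzero (F : numFieldType) (v n : nat) (p : seq ('I_v * 'I_v)) :
    uniq (points p) -> (size p <= n)%N -> (n + size p <= v)%N ->
  pairprod F n p set0 != 0.
Proof.
move=> Up pn nv; move: (Up); rewrite cat_uniq => /and3P[U1 /hasPn dp U2].
have [||C [AC CB cC]] :=
  @set_between _ [set x in unzip1 p] (~: [set x in unzip2 p]) n.
- by apply/subsetP=> x; rewrite !inE; apply: contraL => /dp.
- rewrite cardsE (card_uniqP U1) size_map pn /= -(leq_add2r #|[set x in unzip2 p]|).
  rewrite [X in (_ <= X)%N]addnC cardsC card_ord cardsE.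
  by rewrite (card_uniqP U2) size_map.
have cC' : #|C| == n by apply/eqP.
apply/eqP=> /ffunP/(_ (Sub C cC')) /eqP; apply/negP; rewrite [X in _ != X]ffunE.
rewrite pairprod_neq0 sub0set; apply/allP=> -[a b] pab /=.
have -> : a \in C.
  by apply: (subsetP AC); rewrite inE; apply/mapP; exists (a, b).
have : b \notin ~: [set x in unzip2 p].
  by rewrite !inE negbK; apply/mapP; exists (a, b).
by move/(contra (subsetP CB b)) => /negPf ->.
Qed.

Section SpechtModel.
Variables (F : numFieldType) (v j : nat).
Hypothesis le2jv : (j.*2 <= v)%N.
Local Notation la := (two_row v j).
Local Notation tabt := (tabloid_type v la).
Local Notation tact := (tabloid_act v la).
Local Notation act := (block_act v j).

Lemma le_jv : (j <= v)%N.
Proof. by rewrite (leq_trans _ le2jv) // -addnn leq_addr. Qed.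

Lemma le_j_vj : (j <= v - j)%N.
Proof. by rewrite leq_subRL ?le_jv // addnn. Qed.

Lemma tab_rowE (T : 'S_v) x : tab_row la T x = (v - j <= T x)%N.
Proof.
rewrite /tab_row /reshape_index /= subn_eq0 ltnNge.
case: leqP => //= le; rewrite -subnDA subnK ?le_jv // subn_eq0 ltn_ord //.
Qed.

Lemma tab_colE (T : 'S_v) x :
  tab_col la T x = if (v - j <= T x)%N then (T x - (v - j))%N else T x.
Proof.
rewrite /tab_col /reshape_offset -[reshape_index _ _]/(tab_row la T x) tab_rowE.
by case: leqP => _ /=; rewrite ?addn0 ?subn0.
Qed.

(** Positions are read row by row, so column k < j consists of the positions
    k and v - j + k. *)
Definition upper_pos (k : 'I_j) : 'I_v := widen_ord le_jv k.
Fact lower_pos_subproof (k : 'I_j) : (v - j + k < v)%N.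
Proof. by rewrite -[X in (_ < X)%N](subnK le_jv) ltn_add2l. Qed.
Definition lower_pos (k : 'I_j) : 'I_v := Ordinal (lower_pos_subproof k).

(** The columns of length 2 of the tableau T, lower entry first: the second
    row of T is then a set on which the product of these pairs is 1. *)
Definition column_pairs (T : 'S_v) : seq ('I_v * 'I_v) :=
  [seq ((T^-1)%g (lower_pos k), (T^-1)%g (upper_pos k)) | k <- enum 'I_j].

Lemma size_column_pairs T : size (column_pairs T) = j.
Proof. by rewrite size_map size_enum_ord. Qed.

Lemma uniq_column_pairs T : uniq (points (column_pairs T)).
Proof.
rewrite /points /unzip1 /unzip2 -!(map_comp _ _ (enum 'I_j)) cat_uniq.
apply/and3P; split.
- rewrite map_inj_uniq => [|k l /perm_inj/(congr1 val)/addnI/val_inj //].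
  exact: enum_uniq.
- apply/hasPn=> _ /mapP[k _ ->]; apply/mapP=> -[l _ /=].
  move/perm_inj/(congr1 val) => /= kl.
  by have := leq_trans (ltn_ord k) le_j_vj; rewrite kl ltnNge leq_addr.
rewrite map_inj_uniq => [|k l /perm_inj/(congr1 val)/= /val_inj //].
exact: enum_uniq.
Qed.

Lemma column_pairsP (T : 'S_v) a b :
  reflect (exists2 k : 'I_j, T a = (v - j + k)%N :> nat & T b = k :> nat)
          ((a, b) \in column_pairs T).
Proof.
apply: (iffP mapP) => [[k _ [-> ->]]|[k Ta Tb]].
  by exists k; rewrite permKV.
exists k; rewrite ?mem_enum //; congr pair; apply: (@perm_inj _ T).
  by rewrite permKV; apply: val_inj.
by rewrite permKV; apply: val_inj.
Qed.

Lemma card_second_row (T : 'S_v) : #|[set x | (v - j <= T x)%N]| == j.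
Proof.
rewrite -[X in _ == X](size_column_pairs T) -(size_map fst).
have := uniq_column_pairs T; rewrite cat_uniq => /andP[/card_uniqP<- _].
apply/eqP/eq_card => x; rewrite !inE; apply/idP/mapP => [le|[[a b]]].
  have lt : (T x - (v - j) < j)%N.
    by rewrite ltn_subLR // subnK ?le_jv.
  exists (x, (T^-1)%g (upper_pos (Ordinal lt))) => //.
  by apply/column_pairsP; exists (Ordinal lt); rewrite ?permKV //= subnKC.
by case/column_pairsP=> k Ta _ -> /=; rewrite Ta leq_addr.
Qed.

Definition second_row (T : 'S_v) : block v j :=
  Sub [set x | (v - j <= T x)%N] (card_second_row T).

(** A tabloid of shape (v - j, j) is determined by its second row. *)
Definition block_tabloid (S : block v j) : tabt :=
  ([tuple ~: val S; val S] : 2.-tuple {set 'I_v}).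

Lemma block_tabloid_inj : injective block_tabloid.
Proof. by move=> S S' /(congr1 val)/= [_ /val_inj]. Qed.

Lemma block_tabloid_act S g :
  tact (block_tabloid S) g = block_tabloid (act S g).
Proof.
apply: val_inj => /=; congr [:: _; _].
apply/setP=> x; rewrite [RHS]inE -['P^*%act (val S) g]/(val (act S g)).
rewrite mem_block_act !setactE; apply/imsetP/idP => [[y]|Sx].
  by rewrite inE => Sy ->; rewrite /aperm permK.
by exists ((g^-1)%g x); rewrite ?inE //= /aperm permKV.
Qed.

Lemma tabloidE T : tabloid la T = block_tabloid (second_row T).
Proof.
apply: eq_from_tnth => -[[|[|//]] lti]; rewrite tnth_mktuple (tnth_nth set0) /=.
  by apply/setP=> x; rewrite !inE tab_rowE eqb0.
by apply/setP=> x; rewrite !inE tab_rowE eqb1.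
Qed.

Definition tabloid_lift (h : permMod F (block v j)) : permMod F tabt :=
  \sum_S (h S : F) *: indic F [set block_tabloid S].

Fact tabloid_lift_is_linear : linear tabloid_lift.
Proof.
move=> a h h'; rewrite /tabloid_lift scaler_sumr -big_split; apply: eq_bigr => S _.
by rewrite !ffunE scalerDl scalerA.
Qed.
HB.instance Definition _ :=
  GRing.isLinear.Build F (permMod F (block v j)) (permMod F tabt) *:%R
    tabloid_lift tabloid_lift_is_linear.

Lemma tabloid_liftE h S : tabloid_lift h (block_tabloid S) = h S.
Proof.
rewrite /tabloid_lift sum_ffunE (bigD1 S) //= !ffunE inE eqxx big1 ?addr0.
  by rewrite /GRing.scale /= mulr1.
move=> S' nS'; rewrite !ffunE inE (inj_eq block_tabloid_inj) eq_sym.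
by rewrite (negPf nS') scaler0.
Qed.

Lemma tabloid_lift_eq0 h : tabloid_lift h = 0 -> h = 0.
Proof.
by move=> h0; apply/ffunP=> S; rewrite -tabloid_liftE h0 !ffunE.
Qed.

Lemma tabloid_lift_indic S :
  tabloid_lift (indic F [set S]) = indic F [set block_tabloid S].
Proof.
rewrite /tabloid_lift (bigD1 S) //= ffunE inE eqxx scale1r big1 ?addr0 //.
by move=> S' /negPf nS'; rewrite ffunE inE nS' scale0r.
Qed.

Lemma gtrans_tabloid_lift g h :
  gtrans tact g (tabloid_lift h) = tabloid_lift (gtrans act g h).
Proof.
rewrite /tabloid_lift linear_sum [RHS](reindex_inj (act_inj act g)).
apply: eq_bigr => S _.
by rewrite linearZ /= gtrans_indic1 block_tabloid_act ffunE actK.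
Qed.

(** The polytabloid of T seen as a function on the possible second rows. *)
Definition block_polytabloid (T : 'S_v) : permMod F (block v j) :=
  \sum_(s in column_stab la T)
    (-1) ^+ odd_perm s *: indic F [set act (second_row T) s].

Lemma polytabloidE T :
  polytabloid F la T = tabloid_lift (block_polytabloid T).
Proof.
rewrite /polytabloid /block_polytabloid linear_sum; apply: eq_bigr => s _.
by rewrite linearZ /= tabloid_lift_indic tabloidE block_tabloid_act.
Qed.

Lemma column_stabM (T s u : 'S_v) : s \in column_stab la T ->
  u \in column_stab la T -> (s * u)%g \in column_stab la T.
Proof.
rewrite !inE => /forallP sC /forallP uC; apply/forallP=> x.
by rewrite permM (eqP (uC _)) sC.
Qed.

Lemma tperm_column_stab T a b :
  (a, b) \in column_pairs T -> tperm a b \in column_stab la T.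
Proof.
case/column_pairsP=> k Ta Tb; rewrite inE; apply/forallP=> x.
have ab : tab_col la T a = tab_col la T b.
  have lt : (k < v - j)%N by apply: leq_trans (ltn_ord k) le_j_vj.
  by rewrite !tab_colE Ta Tb leq_addr addKn leqNgt lt.
by case: tpermP => [->|->|//]; rewrite ab.
Qed.

Lemma neq_column_pairs T a b : (a, b) \in column_pairs T -> a != b.
Proof.
move=> /(@perm_to_rem _ _ _)/points_perm/perm_uniq.
by rewrite uniq_column_pairs uniq_points_cons => /esym/and4P[].
Qed.

Lemma block_polytabloid_swap T a b : (a, b) \in column_pairs T ->
  gtrans act (tperm a b) (block_polytabloid T) = - block_polytabloid T.
Proof.
move=> Tab; have uC := tperm_column_stab Tab.
have nab := neq_column_pairs Tab; set u := tperm a b in uC *.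
rewrite /block_polytabloid linear_sum -sumrN [RHS](reindex_inj (mulIg u)) /=.
have uu s : (s * u * u)%g = s by rewrite -mulgA tperm2 mulg1.
have CuE s : (s * u \in column_stab la T)%g = (s \in column_stab la T).
  by apply/idP/idP=> sC; [rewrite -(uu s)|]; apply: column_stabM.
apply: eq_big => [s|s _]; first by rewrite CuE.
rewrite linearZ /= gtrans_indic1 -actM odd_permM odd_tperm nab addbT.
by rewrite signrN scaleNr opprK.
Qed.

(** Such an s preserves the rows and the columns of T, hence every cell.  So
    the tabloid of T occurs only once in its polytabloid, with coefficient 1. *)
Lemma column_stab_fix (T s : 'S_v) : s \in column_stab la T ->
  act (second_row T) s = second_row T -> s = 1%g.
Proof.
rewrite inE => /forallP sC sS; apply/permP=> x; rewrite perm1.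
have := sC x; rewrite !tab_colE.
have : (s x \in val (act (second_row T) s)) = (x \in val (second_row T)).
  by rewrite mem_block_act permK.
rewrite sS !inE => rE E; apply: (@perm_inj _ T); apply: val_inj => /=.
move: rE E; case: (leqP (v - j) (T x)) => [le|_] rE; rewrite rE => /eqP E //.
by rewrite -(subnK le) -E subnK.
Qed.

Lemma block_polytabloid_neq0 T : block_polytabloid T != 0.
Proof.
apply/eqP=> /ffunP/(_ (second_row T)) /eqP; rewrite [X in _ == X]ffunE.
apply/negP; rewrite /block_polytabloid sum_ffunE (bigD1 1%g); last first.
  by rewrite inE; apply/forallP=> x; rewrite perm1.
rewrite !ffunE act1 inE eqxx odd_perm1 expr0 scale1r big1 /= ?addr0 ?oner_eq0 //.
move=> s /andP[sC ns]; rewrite !ffunE inE eq_sym.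
have [/(column_stab_fix sC) s1|_] := eqVneq; first by rewrite s1 eqxx in ns.
by rewrite scaler0.
Qed.

(** For blocks of size j the condition of pairprod_unique on transpositions of
    points outside the pairs is void: a block meeting the j pairs once each has
    no other point. *)
Lemma swap_eigenvector T (h : permMod F (block v j)) :
    (forall a b, (a, b) \in column_pairs T ->
       gtrans act (tperm a b) h = - h) ->
  exists c : F, h = c *: pairprod F j (column_pairs T) set0.
Proof.
move=> hswap; apply: pairprod_unique hswap _; first exact: uniq_column_pairs.
move=> x y B px _; rewrite pairprod_neq0 => /andP[_ pB] Bx.
have := count_points pB; rewrite -card_points_count ?uniq_column_pairs //.
rewrite size_column_pairs -[RHS](card_block B) => cB.
have /eqP BE : val B :&: [set x in points (column_pairs T)] == val B.
  by rewrite eqEcard subsetIl cB leqnn.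
by move: Bx px; rewrite -BE !inE => /andP[_ ->].
Qed.

Lemma block_polytabloid_pairprod T : exists2 c : F, c != 0 &
  pairprod F j (column_pairs T) set0 = c *: block_polytabloid T.
Proof.
have [|c Ec] := @swap_eigenvector T (block_polytabloid T).
  exact: block_polytabloid_swap.
have c0 : c != 0.
  by apply: contraNneq (block_polytabloid_neq0 T) => c0; rewrite Ec c0 scale0r.
by exists c^-1; rewrite ?invr_eq0 // Ec scalerK.
Qed.

End SpechtModel.

(** * The isomorphism with the Specht module *)

Lemma module_iso_dim (gT : finGroupType) (F : fieldType) (I1 I2 : finType)
    (to1 : {action gT &-> I1}) (W1 : {vspace permMod F I1})
    (to2 : {action gT &-> I2}) (W2 : {vspace permMod F I2}) :
  module_iso to1 W1 to2 W2 -> \dim W1 = \dim W2.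
Proof.
case=> phi [phi_inj <- _]; rewrite limg_dim_eq //.
apply/vspaceP=> f; rewrite memv_cap memv_ker memv0.
apply/andP/eqP=> [[Wf /eqP f0]|->]; last by rewrite mem0v linear0.
by apply: phi_inj; rewrite ?mem0v ?linear0.
Qed.

Section YoungSpecht.
Variables (F : numFieldType) (v n j : nat).
Local Notation pairs := (seq ('I_v * 'I_v)).
Local Notation M := (permMod F (block v n)).
Local Notation act := (block_act v n).
Local Notation pp := (pairprod F n).
Local Notation U := (young_space F v n).
Local Notation la := (two_row v j).
Local Notation tact := (tabloid_act v la).
Implicit Types (p : pairs) (S : {set 'I_v}) (B : block v n) (f : M).

Definition degree f : permMod F (block v j) :=
  [ffun S : block v j => dot f (pp [::] (val S)) : F].

Fact degree_is_linear : linear degree.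
Proof.
move=> a f h; apply/ffunP=> S; rewrite !ffunE ![dot _ (pp _ _)]dotC.
by rewrite linearP.
Qed.
HB.instance Definition _ :=
  GRing.isLinear.Build F M (permMod F (block v j)) *:%R degree degree_is_linear.

Lemma gtrans_degree g f :
  gtrans (block_act v j) g (degree f) = degree (gtrans act g f).
Proof.
apply/ffunP=> S; rewrite !ffunE dot_gtrans gtrans_pairprod /=.
by rewrite setactE.
Qed.

Lemma degree_eq0_dot f p : degree f = 0 -> uniq (points p) -> size p = j ->
  dot f (pp p set0) = 0.
Proof.
move=> /ffunP f0 Up pj; rewrite (dot_pairprod_const (k := j) (c := 0)) //.
- by case: (p).
- move=> S /eqP cS; have := f0 (Sub S cS).
  by rewrite !ffunE.
- by apply: eq_disjoint0 => x; rewrite inE.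
by rewrite cards0 addn0.
Qed.

Hypotheses (le2jv : (j.*2 <= v)%N) (le_jn : (j <= n)%N).
Hypothesis le_njv : (n + j <= v)%N.

Definition specht_map : 'Hom(M, permMod F (tabloid_type v la)) :=
  linfun (@tabloid_lift F v j \o degree).

Lemma specht_mapE f : specht_map f = tabloid_lift (degree f).
Proof. by rewrite lfunE. Qed.

Lemma pairprod_column_neq0 (T : 'S_v) : pp (column_pairs le2jv T) set0 != 0.
Proof.
by apply: pairprod_nonzero; rewrite ?size_column_pairs ?uniq_column_pairs.
Qed.

(** The constant is not zero: otherwise E_p, a combination of the inclusion
    functions of j-sets, would be orthogonal to itself. *)
Lemma specht_map_pairprod T : exists2 c : F, c != 0 &
  specht_map (pp (column_pairs le2jv T) set0) = c *: polytabloid F la T.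
Proof.
set p := column_pairs le2jv T; pose E := pp p set0.
have Up : uniq (points p) := uniq_column_pairs le2jv T.
have [|c Ec] := @swap_eigenvector F v j le2jv T (degree E).
  by move=> a b pab; rewrite gtrans_degree gtrans_pair_swap // linearN.
have [d d0 Ed] := block_polytabloid_pairprod F le2jv T.
exists (c * d); last first.
  by rewrite specht_mapE Ec Ed !linearZ /= scalerA polytabloidE.
rewrite mulf_neq0 //; apply/eqP=> c0.
have /eqP := dot_pairprod_self (pairprod_column_neq0 T); apply.
by apply: degree_eq0_dot; rewrite ?size_column_pairs // Ec c0 scale0r.
Qed.

Lemma pairing_column p : uniq (points p) -> size p = j ->
  exists T, p = column_pairs le2jv T.
Proof.
move=> Up pj.
have [|g <-] := map_pairs_trans (uniq_column_pairs le2jv 1%g) Up.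
  by rewrite size_column_pairs.
exists g^-1%g; rewrite /map_pairs -map_comp; apply: eq_map => k /=.
by rewrite invg1 !perm1 invgK.
Qed.

(** An element of U_j in the kernel is orthogonal to the inclusion functions
    of j-sets, hence to U_j, and to the other U_i by orthogonality, so it is 0. *)
Lemma young_specht : module_iso act (U j) tact (specht F v la).
Proof.
exists specht_map; split.
- move=> f h Uf Uh E; apply/eqP; rewrite -subr_eq0; apply/eqP.
  have fh0 : degree (f - h) = 0.
    by apply: tabloid_lift_eq0; rewrite -specht_mapE linearB /= E subrr.
  apply: young_nondegenerate => i g Ug.
  have [ij|nij] := eqVneq j i; last first.
    by apply: young_orthogonal nij _ Ug; rewrite rpredB.
  rewrite -ij in Ug; apply: young_space_dot0 Ug => p Up pj.
  exact: degree_eq0_dot.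
- rewrite limg_span; apply/eqP; rewrite eqEsubv.
  apply/andP; split; apply/span_subvP=> x.
    case/mapP=> _ /imageP[p Up ->] ->.
    have [T ->] := pairing_column Up (size_tuple p).
    have [c _ ->] := specht_map_pairprod T.
    by rewrite rpredZ //; apply/memv_span/image_f.
  case/imageP=> T _ ->; have [c c0 Ec] := specht_map_pairprod T.
  rewrite -[polytabloid _ _ _](scalerK c0) -Ec rpredZ //.
  rewrite memv_span // map_f //; apply/imageP.
  have sz : size (column_pairs le2jv T) == j by rewrite size_column_pairs.
  by exists (Tuple sz) => //=; exact: (uniq_column_pairs le2jv T).
move=> g f _; rewrite !specht_mapE gtrans_tabloid_lift; congr tabloid_lift.
by rewrite gtrans_degree.
Qed.

(** Take w in W with the same image as E_p in the Specht module.  Signed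
    averaging multiplies E_p, hence w, by a nonzero number, and it maps every
    function to a multiple of E_p.  So E_p is in W, and dimensions agree. *)
Lemma young_specht_unique (W : {vspace M}) : submodule act W ->
  module_iso act W tact (specht F v la) -> W = U j.
Proof.
move=> sW isoW; have dW := module_iso_dim isoW.
have dU := module_iso_dim young_specht.
apply/esym/eqP; rewrite eqEdim dW dU leqnn andbT.
case: isoW => phi [phi_inj phiW phiG].
case: young_specht => psi [psi_inj psiU psiG].
pose p := column_pairs le2jv 1%g; pose E := pp p set0.
have Up : uniq (points p) := uniq_column_pairs le2jv 1%g.
have pj : size p = j := size_column_pairs le2jv 1%g.
have E0 : E != 0 := pairprod_column_neq0 1%g.
have UE : E \in U j by rewrite -pj; apply: mem_young_space.
have /memv_imgP[w Ww Ew] : psi E \in (phi @: W)%VS.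
  by rewrite phiW -psiU memv_img.
have sgn_w : sign_avg act E act w = sign_weight act E *: w.
  apply: phi_inj; rewrite ?rpredZ ?sign_avg_submodule //.
  rewrite (sign_avg_hom _ _ phiG) // -Ew -(sign_avg_hom _ _ psiG) //.
  by rewrite sign_avg_self // !linearZ /= Ew.
have [c [Ec _]] := sign_avg_pairprod w Up E0.
rewrite -pj; apply: young_space_sub => //.
have N0 := sign_weight_neq0 act E0.
have c0 : c != 0.
  apply: contraNneq E0 => c0; move: Ec; rewrite sgn_w c0 scale0r => /eqP.
  rewrite scaler_eq0 (negPf N0) /= => /eqP w0.
  apply/eqP/psi_inj; rewrite ?mem0v //.
  by rewrite Ew w0 !linear0.
by rewrite -[pp p _](scalerK c0) -Ec sgn_w !rpredZ.
Qed.

(** A submodule of U_j that does not contain U_j is orthogonal to U_j by the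
    dichotomy, and to the other U_i because it lies in U_j. *)
Lemma young_irreducible : irreducible_module act (U j).
Proof.
have E0 := pairprod_column_neq0 1%g; split.
- exact: young_space_submodule.
- apply/eqP; rewrite -subv0; apply: contra E0 => /subvP U0.
  rewrite -memv0 U0 // -[in U j](size_column_pairs le2jv 1%g).
  by apply/mem_young_space/uniq_column_pairs.
move=> W sW WU; have [->|W0] := eqVneq W 0%VS; [by left | right].
apply/eqP; rewrite eqEsubv WU /=.
case: (pickP (fun p : j.-tuple ('I_v * 'I_v) =>
   uniq (points p) && (dot (vpick W) (pp p set0) != 0))) => [p|noP].
  case/andP=> Up nz; rewrite -(size_tuple p).
  by rewrite (young_space_dichotomy _ _ _ nz) ?memv_pick.
case/negP: W0; rewrite -vpick0; apply/eqP/young_nondegenerate => i g Ug.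
have UW : vpick W \in U j by apply: (subvP WU); apply: memv_pick.
have [ij|nij] := eqVneq j i; last exact: young_orthogonal nij UW Ug.
rewrite -ij in Ug; apply: young_space_dot0 Ug => p Up /eqP pj.
apply/eqP; have := noP (Tuple pj).
by rewrite /= Up /= => /negbFE.
Qed.

(** The average of phi E_p is a nonzero multiple of phi E_p, but it is 0
    because U_i is orthogonal to E_p. *)
Lemma young_non_iso i : i != j -> ~ module_iso act (U j) act (U i).
Proof.
move=> nij [phi [phi_inj phiU phiG]].
pose p := column_pairs le2jv 1%g; pose E := pp p set0.
have Up : uniq (points p) := uniq_column_pairs le2jv 1%g.
have pj : size p = j := size_column_pairs le2jv 1%g.
have E0 : E != 0 := pairprod_column_neq0 1%g.
have UE : E \in U j by rewrite -pj; apply: mem_young_space.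
have [c [Ec cN]] := sign_avg_pairprod (phi E) Up E0.
have phiE : dot (phi E) E = 0.
  by apply: (young_orthogonal nij _ UE); rewrite -phiU memv_img.
have c0 : c = 0.
  apply/eqP; move/eqP: cN; rewrite phiE mulr0.
  by rewrite mulf_eq0 (negPf (dot_pairprod_self E0)) orbF.
move: Ec; rewrite -(sign_avg_hom _ _ phiG) // sign_avg_self // c0 scale0r.
rewrite linearZ /=.
move/eqP; rewrite scaler_eq0 (negPf (sign_weight_neq0 act E0)) /= => /eqP phi0.
case/eqP: E0; apply: phi_inj; rewrite ?mem0v //.
by rewrite phi0 linear0.
Qed.

End YoungSpecht.

(** * Young's rule and dimensions *)

Section YoungRule.
Variables (v n : nat).
Hypothesis le2nv : (2 * n <= v)%N.

Fact young_bounds (j : 'I_n.+1) :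
  [/\ (j.*2 <= v)%N, (j <= n)%N & (n + j <= v)%N].
Proof.
have jn : (j <= n)%N by rewrite -ltnS.
have nj : (n + j <= v)%N.
  by apply: leq_trans le2nv; rewrite mul2n -addnn leq_add2l.
by split=> //; apply: leq_trans nj; rewrite -addnn leq_add2r.
Qed.

(** The functions E_p that span U_j are real-valued, so conjugation does not
    change them. *)
Lemma young_orthogonal_conj (C : numClosedFieldType) i j : i != j ->
  orthogonal_spaces (young_space C v n i) (young_space C v n j).
Proof.
move=> nij f h Uf.
apply: (young_space_ind (P := fun h : permMod C (block v n) =>
  \sum_x (f x : C) * (h x : C)^* = 0)).
- by rewrite big1 // => x _; rewrite ffunE rmorph0 mulr0.
- move=> a u w hu hw.
  under eq_bigr do rewrite !ffunE rmorphD rmorphM mulrDr mulrCA.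
  by rewrite big_split /= -mulr_sumr hu hw mulr0 addr0.
move=> p Up pj.
have Up' : pairprod C n p set0 \in young_space C v n j.
  by rewrite -pj mem_young_space.
rewrite -[RHS](young_orthogonal nij Uf Up'); apply: eq_bigr => x _.
congr (_ * _).
rewrite ffunE rmorphM rmorph_nat rmorph_prod; congr (_ * _).
by apply: eq_bigr => q _; rewrite rmorphB !rmorph_nat.
Qed.

Lemma young_space_decomposition (C : numClosedFieldType) :
  young_decomposition (fun j : 'I_n.+1 => young_space C v n j).
Proof.
split.
- by move=> j; have [j2 jn nj] := young_bounds j; apply: young_irreducible.
- by move=> i j nij; apply: young_orthogonal_conj.
- exact: young_independent.
- exact: young_full.
- move=> i j nij; have [i2 iN ni] := young_bounds i.
  by apply: young_non_iso => //; rewrite eq_sym.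
- by move=> j; have [j2 jn nj] := young_bounds j; apply: young_specht.
move=> j W sW isoW; have [j2 jn nj] := young_bounds j.
exact: young_specht_unique.
Qed.

End YoungRule.

(** Completeness for the m-subsets; the point is that the summands do not
    depend on m. *)
Lemma sum_dim_specht (F : numFieldType) (v m : nat) : (2 * m <= v)%N ->
  (\sum_(j < m.+1) \dim (specht F v (two_row v j)) = 'C(v, m))%N.
Proof.
move=> le2mv; have := dim_permMod F (block v m).
rewrite -young_full (directvP (young_independent F v (n := m) predT)) /=.
have -> : #|{: block v m}| = 'C(v, m).
  rewrite card_sig -[v in RHS]card_ord -card_draws.
  by apply: eq_card => x; rewrite !inE.
move=> <-; apply: eq_bigr => j _; have [j2 jm mj] := young_bounds le2mv j.
by rewrite (module_iso_dim (young_specht F j2 jm mj)).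
Qed.

Lemma dim_young_sum (F : numFieldType) (v n t : nat) :
    (2 * n <= v)%N -> (t <= n)%N ->
  \dim (\sum_(j < n.+1 | (j == ord0) || (t < j)%N) young_space F v n j)%VS
    = ('C(v, n) - 'C(v, t) + 1)%N.
Proof.
move=> le2nv le_tn; pose d j := \dim (specht F v (two_row v j)).
have le2tv : (2 * t <= v)%N by apply: leq_trans le2nv; rewrite leq_mul2l.
rewrite (directvP (young_independent _ _ _)) /=.
under eq_bigr => j _.
  have [j2 jn nj] := young_bounds le2nv j.
  rewrite (module_iso_dim (young_specht F j2 jn nj)) -/(d j).
  over.
rewrite -(big_mkord (fun j => (j == 0) || (t < j))%N d).
have d0 : d 0 = 1%N.
  by have := @sum_dim_specht F v 0 isT; rewrite big_ord1 bin0.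
have sumE m : (2 * m <= v)%N -> 'C(v, m) = (1 + \sum_(1 <= j < m.+1) d j)%N.
  move/(sum_dim_specht F) <-.
  transitivity (\sum_(0 <= j < m.+1) d j)%N; first by rewrite big_mkord.
  by rewrite big_ltn // d0.
rewrite (sumE n) // (sumE t) // subnDl addnC.
rewrite big_ltn_cond //= d0; congr (_ + _)%N.
rewrite [in RHS](@big_cat_nat _ _ _ t.+1) //= addKn.
rewrite (@big_cat_nat _ _ _ t.+1) //= big_nat_cond big_pred0 ?add0n; last first.
  move=> [|j] //=; case: (ltnP t j.+1) => [tj|_]; last by rewrite andbF.
  by rewrite [(_.+1 < t.+1)%N]ltnS leqNgt tj.
rewrite big_nat_cond [RHS]big_nat_cond; apply: eq_bigl => j.
by case: (ltnP t j); rewrite ?orbT ?andbF ?andbT.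
Qed.

(** * Designs *)

Section Designs.
Variables (F : numFieldType) (v n t lam : nat) (D : {set block v n}).
Hypotheses (le_tn : (t <= n)%N) (lam_gt0 : (0 < lam)%N).
Hypothesis designD : is_design t lam D.
Local Notation pairs := (seq ('I_v * 'I_v)).
Local Notation M := (permMod F (block v n)).
Local Notation act := (block_act v n).
Local Notation pp := (pairprod F n).
Local Notation U := (young_space F v n).
Local Notation f := (indic F D).
Implicit Types (p : pairs) (S Y : {set 'I_v}) (B : block v n).

Lemma dot_indic (h : M) : dot f h = \sum_(B in D) (h B : F).
Proof.
rewrite [RHS]big_mkcond; apply: eq_bigr => B _; rewrite ffunE.
by case: (B \in D); rewrite ?mul1r ?mul0r.
Qed.

Lemma dot_indic_subset S :
  dot f (pp [::] S) = #|[set B in D | S \subset val B]|%:R.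
Proof.
rewrite dot_indic -sum1_card natr_sum big_set /= big_mkcondr /=.
by apply: eq_bigr => B _; rewrite ffunE big_nil mul1r; case: (S \subset _).
Qed.

(** A t-design is a k-design for every k <= t.  This is read off from
    sum_pairprod_setU1 with p empty, by descending induction on k. *)
Lemma design_degree_const k : (k <= t)%N ->
  exists c : F, forall S, #|S| = k -> dot f (pp [::] S) = c.
Proof.
move=> le_kt; have [m] := ubnP (t - k); elim: m k le_kt => // m IHm k le_kt.
rewrite ltnS => tkm; have [lt_kt|le_tk] := ltnP k t; last first.
  have -> : k = t by apply/eqP; rewrite eqn_leq le_kt.
  by exists lam%:R => S cS; rewrite dot_indic_subset designD.
have [||c Ec] := IHm k.+1; rewrite ?lt_kt //.
  by apply: leq_trans tkm; rewrite ltn_sub2l.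
exists ((n - k)%:R^-1 * ((v - k)%:R * c)) => S cS.
have dS : [disjoint S & points ([::] : pairs)].
  by rewrite disjoint_sym disjoint_has.
have /(congr1 (dot f)) := @sum_pairprod_setU1 F v n [::] S isT dS.
rewrite linear_sum dotZr /= add0n cS => E.
apply: canRL (mulKf _) _.
  by rewrite pnatr_eq0 -lt0n subn_gt0 (leq_trans lt_kt).
rewrite -E; under eq_bigr => b Sb do rewrite Ec ?cardsU1 ?Sb ?cS //.
have -> : (v - k)%N = #|~: S| by rewrite cardsCs setCK card_ord cS.
by rewrite sumr_const mulr_natl; congr (_ *+ _); apply: eq_card => x; rewrite inE.
Qed.

Lemma design_orthogonal j : (0 < j <= t)%N -> {in U j, forall h, dot f h = 0}.
Proof.
case/andP=> j0 jt; have [c fc] := design_degree_const jt.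
apply: young_space_dot0 => p Up pj.
rewrite (dot_pairprod_const fc) ?cards0 ?addn0 //; last first.
  by apply: eq_disjoint0 => x; rewrite inE.
by case: p pj {Up} => // p0; rewrite -p0 in j0.
Qed.

(** Such a block contains one of the t-subsets of Y, and each t-subset is in
    lam blocks. *)
Lemma card_heavy_blocks Y :
  (#|[set B in D | t <= #|Y :&: val B|]| <= 2 ^ #|Y| * lam)%N.
Proof.
have sub : [set B in D | t <= #|Y :&: val B|]%N \subset
    \bigcup_(T in powerset Y | #|T| == t) [set B in D | T \subset val B].
  apply/subsetP=> B; rewrite inE => /andP[DB /subset_of_card[T]].
  rewrite subsetI => /andP[TY TB] /eqP cT; apply/bigcupP; exists T.
    by rewrite powersetE TY.
  by rewrite inE DB.
apply: leq_trans (subset_leq_card sub) _.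
apply: (@leq_trans (\sum_(T in powerset Y | #|T| == t) lam)).
  elim/big_rec2: _ => [|T k A /andP[_ /eqP/designD cT] le].
    by rewrite cards0.
  by rewrite (leq_trans (leq_card_setU _ _)) // cT leq_add2l.
rewrite sum_nat_const leq_mul2r -card_powerset; apply/orP; right.
by apply/subset_leq_card/subsetP=> T /andP[].
Qed.

Hypothesis v_large : (2 * n + 2 ^ (2 * n) * lam * n < v)%N.

Lemma point_off_heavy_blocks Y : (#|Y| <= 2 * n)%N ->
  exists2 b, b \notin Y &
    {in D, forall B, (t <= #|Y :&: val B|)%N -> b \notin val B}.
Proof.
move=> cY; pose H := [set B in D | t <= #|Y :&: val B|]%N.
pose N := Y :|: \bigcup_(B in H) val B.
have ltN : (#|N| < #|'I_v|)%N.
  rewrite card_ord; apply: leq_ltn_trans v_large.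
  apply: leq_trans (leq_card_setU _ _) _; apply: leq_add => //.
  apply: (@leq_trans (\sum_(B in H) n)%N).
    elim/big_rec2: _ => [|B k A _ le]; first by rewrite cards0.
    by rewrite (leq_trans (leq_card_setU _ _)) // card_block leq_add2l.
  rewrite sum_nat_const leq_mul2r; apply/orP; right.
  apply: leq_trans (card_heavy_blocks Y) _.
  by rewrite leq_mul2r leq_exp2l // cY orbT.
have /card_gt0P[b] : (0 < #|~: N|)%N.
  by rewrite -(ltn_add2l #|N|) cardsC addn0.
rewrite !inE negb_or => /andP[Yb /bigcupP Hb]; exists b => // B DB tB.
by apply/negP=> Bb; apply: Hb; exists B; rewrite // inE DB.
Qed.

(** Replacing an element a of S by the pair (a, b) subtracts the function of
    p and b |: S :\ a.  A block where it does not vanish contains b and at least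
    t of the points used before, which the choice of b rules out. *)
Lemma design_pairprod_extend p S : uniq (points p) -> [disjoint S & points p] ->
    (t < size p + #|S| <= n)%N -> dot f (pp p S) != 0 ->
  exists q : pairs, [/\ uniq (points q), size q = (size p + #|S|)%N &
    dot f (pp q set0) != 0].
Proof.
have [m] := ubnP #|S|; elim: m => // m IHm in p S *.
rewrite ltnS => leSm Up dSp /andP[lt_ts le_sn] fpS.
have [S0|[a Sa]] := set_0Vmem S.
  by exists p; rewrite Up -S0 S0 cards0 addn0 -S0.
pose S' := S :\ a; have defS : S = a |: S' by rewrite setD1K.
have cS : #|S| = #|S'|.+1 by rewrite (cardsD1 a) Sa.
have dS'p : [disjoint S' & points p].
  by apply: disjointWl dSp; apply/subsetP=> x /setD1P[].
have pa : a \notin points p by rewrite (disjointFr dSp Sa).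
pose Y := S :|: [set x in points p].
have cY : (#|Y| <= 2 * n)%N.
  apply: leq_trans (leq_card_setU _ _) _.
  rewrite cardsE (card_uniqP Up) size_points.
  apply: leq_trans (_ : 2 * (size p + #|S|) <= _)%N; last by rewrite leq_mul2l.
  by rewrite mul2n doubleD addnC leq_add2l -addnn leq_addr.
have [b Yb bH] := point_off_heavy_blocks cY.
have [Sb pb] : b \notin S /\ b \notin points p.
  by move: Yb; rewrite !inE negb_or => /andP.
have nba : b != a by apply: contraNneq Sb => ->.
have fb : dot f (pp p (b |: S')) = 0.
  rewrite dot_indic big1 // => B DB.
  apply/eqP; apply: contraTT (erefl true) => BpS.
  move: (BpS); rewrite pairprod_neq0 subUset sub1set => /andP[/andP[Bb S'B] pB].
  suff : b \notin val B by rewrite Bb.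
  apply: bH => //; rewrite -ltnS (leq_trans lt_ts) // cS addnS ltnS.
  rewrite -(count_points pB) -card_points_count // -cardsUI.
  rewrite (_ : _ :&: S' = set0) ?cards0 ?addn0; last first.
    apply/setP=> x; rewrite !inE; apply/negP=> /and3P[/andP[_ px] _ Sx].
    by rewrite (disjointFr dSp Sx) in px.
  apply/subset_leq_card/subsetP=> x; rewrite !inE.
  case/orP=> [/andP[-> ->]|/andP[xa Sx]]; first by rewrite orbT.
  by rewrite Sx (subsetP S'B) // !inE xa.
have [|||||q [Uq sq fq]] := IHm ((a, b) :: p) S'.
- by rewrite -ltnS -cS.
- by rewrite uniq_points_cons eq_sym nba pa pb.
- rewrite (eq_disjoint_r (perm_mem (points_cons a b p))).
  rewrite disjoint_sym !disjoint_cons disjoint_sym dS'p !inE eqxx (negPf Sb).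
  by rewrite andbF.
- by rewrite /= addSnnS -cS lt_ts.
- by rewrite pairprod_cons linearB /= fb subr0 -defS.
by exists q; rewrite sq /= addSnnS -cS.
Qed.

Hypothesis le_nv : (n <= v)%N.

Lemma design_neq0 : exists B, B \in D.
Proof.
have [|T _ cT] := @subset_of_card _ [set: 'I_v] t.
  by rewrite cardsT card_ord (leq_trans le_tn).
have /card_gt0P[B] : (0 < #|[set B in D | T \subset val B]|)%N.
  by rewrite designD.
by rewrite inE => /andP[DB _]; exists B.
Qed.

Lemma design_not_orthogonal j : (j <= n)%N -> (j == 0%N) || (t < j)%N ->
  exists p, [/\ uniq (points p), size p = j & dot f (pp p set0) != 0].
Proof.
move=> jn j0t; have [B DB] := design_neq0.
have f_neq0 S : S \subset val B -> dot f (pp [::] S) != 0.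
  move=> SB; rewrite dot_indic_subset pnatr_eq0 -lt0n; apply/card_gt0P.
  by exists B; rewrite inE DB.
case/orP: j0t => [/eqP->|lt_tj].
  by exists [::]; rewrite f_neq0 ?sub0set.
have [|S SB cS] := @subset_of_card _ (val B) j; first by rewrite card_block.
have [||||q [Uq sq fq]] := @design_pairprod_extend [::] S.
- by [].
- by rewrite disjoint_sym disjoint_has.
- by rewrite add0n cS lt_tj.
- exact: f_neq0.
by exists q; rewrite sq add0n cS.
Qed.

(** The components of f in U_1, ..., U_t vanish by orthogonality, and each of
    the other U_j is contained in the orbit span by the dichotomy. *)
Lemma design_span_young : design_span F D =
  (\sum_(j < n.+1 | (j == ord0) || (t < j)%N) U j)%VS.
Proof.
apply/eqP; rewrite eqEsubv; apply/andP; split; last first.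
  apply/subv_sumP=> j j0t.
  have jn : (j <= n)%N by rewrite -ltnS.
  have [p [Up pj fp]] := design_not_orthogonal jn j0t.
  rewrite -pj; apply: young_space_dichotomy (mem_orbit_span _ _) fp => //.
  exact: orbit_span_submodule.
set W := (\sum_(j < n.+1 | _) _)%VS.
have sW : submodule act W.
  move=> g h /memv_sumP[u uU ->]; rewrite linear_sum; apply: memv_sumr => j Pj.
  exact/young_space_submodule/uU.
suff Wf : f \in W by apply/span_subvP => _ /imageP[g _ ->]; apply: sW.
have : f \in (\sum_(j < n.+1) U j)%VS by rewrite young_full memvf.
case/memv_sumP=> u uU fE.
rewrite fE (bigID (fun j : 'I_n.+1 => (j == ord0) || (t < j)%N)) /=.
rewrite [X in _ + X]big1.
  by rewrite addr0; apply: memv_sumr => j _; apply: uU.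
move=> j; rewrite negb_or -leqNgt => /andP[j0 jt].
apply: young_nondegenerate => i h Uh.
have [ij|nij] := eqVneq (j : nat) i; last first.
  exact: young_orthogonal nij (uU _ isT) Uh.
have <- : dot f h = dot (u j) h.
  rewrite fE dotC linear_sum (bigD1 j) //= big1 ?addr0 1?dotC // => k nkj.
  by rewrite dotC; apply: young_orthogonal _ (uU _ isT) Uh; rewrite -ij.
by apply: design_orthogonal Uh; rewrite -ij jt lt0n j0.
Qed.

End Designs.

Theorem theorem5p7 (n t lam : nat)
    (n_gt0 : (0 < n)%N) (t_gt0 : (0 < t)%N) (lam_gt0 : (0 < lam)%N)
    (le_tn : (t <= n)%N) :
  exists v0 : nat, forall (R : realType) (v : nat),
    (v0 <= v)%N -> (2 * n <= v)%N ->
    exists U : 'I_n.+1 -> {vspace permMod R[i] (block v n)},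
      young_decomposition U /\
      forall D : {set block v n}, is_design t lam D ->
        design_span R[i] D = (U ord0 + \sum_(j < n.+1 | (t < j)%N) U j)%VS /\
        \dim (design_span rat D) = ('C(v, n) - 'C(v, t) + 1)%N.
Proof.
(* A set of at most 2 n points is heavily met by at most 2 ^ (2 n) lam blocks,
   which have n points each; one point must remain outside all of these. *)
exists (2 * n + 2 ^ (2 * n) * lam * n).+1 => R v v_large le2nv.
have le_nv : (n <= v)%N by rewrite (leq_trans _ le2nv) // leq_pmull.
exists (fun j : 'I_n.+1 => young_space R[i] v n j); split.
  exact: young_space_decomposition.
move=> D designD; split; last first.
  by rewrite (design_span_young _ le_tn lam_gt0) // dim_young_sum.
rewrite (design_span_young _ le_tn lam_gt0) // (bigD1 ord0) //=; congr (_ + _)%VS.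
by apply: eq_bigl => j; case: eqVneq => [->|]; rewrite ?andbT.
Qed.
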